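(* Let $\mathcal{H}$ be a cancellative $3$-graph on $n$ vertices and let $G=\partial\mathcal{H}$. Let $U\subset V(\mathcal{H})$ be a set of size $m$, and let $G_U=G[U]$ and $\mathcal{H}_U=\mathcal{H}[U]$ be the induced subgraphs on $U$. Suppose that $|G_U|=xm^2/2$ for some real number $x$ with $0\le x\le(m-1)/m$. Then \[ |\mathcal{H}_U|\le\frac{(1-x)x}{6}m^3+3m^2. \]
   Context: A $3$-graph $\mathcal{H}$ is a finite vertex set with a set of $3$-element subsets (edges). The shadow $\partial\mathcal{H}=\{A\in\binom{V(\mathcal{H})}{2}: A\subset B\text{ for some }B\in\mathcal{H}\}$ is viewed as a graph on $V(\mathcal{H})$. $\mathcal{T}_3$ is the collection of all $3$-graphs on at most $5$ vertices with $3$ edges $A,B,C$ such that $A\triangle B\subset C$; a $3$-graph is cancellative iff it contains no member of $\mathcal{T}_3$ as a (not necessarily induced) subgraph. *)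

(* Defs.v *)
From mathcomp Require Import all_boot all_order all_algebra.

Set Implicit Arguments.
Unset Strict Implicit.
Unset Printing Implicit Defensive.

(* A (hyper)graph is given by its edge set on the full vertex set V; [#|E|] is
   then the number of edges. *)

Definition uniform (k : nat) (V : finType) (E : {set {set V}}) : Prop :=
  forall e, e \in E -> #|e| = k.

Definition is_3graph (V : finType) (H : {set {set V}}) : Prop := uniform 3 H.

Definition shadow (V : finType) (H : {set {set V}}) : {set {set V}} :=
  [set A : {set V} | (#|A| == 2) && [exists B in H, A \subset B]].

Definition induced (V : finType) (E : {set {set V}}) (U : {set V}) :
  {set {set V}} := [set e in E | e \subset U].

Definition symdiff (V : finType) (A B : {set V}) : {set V} :=
  (A :\: B) :|: (B :\: A).

Definition in_T3 (W : finType) (F : {set {set W}}) : Prop :=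
  [/\ is_3graph F, #|W| <= 5, #|F| = 3
    & exists A B C : {set W}, F = [set A; B; C] /\ symdiff A B \subset C].

(* H contains a copy of F as a not necessarily induced subgraph. *)
Definition contains (V W : finType) (H : {set {set V}}) (F : {set {set W}}) :
  Prop :=
  exists f : W -> V, injective f /\ forall e, e \in F -> f @: e \in H.

Definition cancellative (V : finType) (H : {set {set V}}) : Prop :=
  forall (W : finType) (F : {set {set W}}), in_T3 F -> ~ contains H F.

(* Main.v *)
(**
Let m = |U|, e = |G_U|, and for w in U let d(w) and h(w) be its degrees in G_U
and H_U.  For a pair uv of G_U, cancellativity makes the set N(uv) of vertices
w in U with uvw in H independent in the shadow; so |N(uv)| <= m - d(w) for each
w in N(uv), and summing 1 / (m - d(w)) over all uvw gives
    sum_w h(w) / (m - d(w)) <= e.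
Put f(m, e) = e (m^2 - 2e) / (3m), the main term of the bound.  Let B(d) be
the first-order change of f when m drops by 1 and e drops by d.  Then
B(d) / (m - d) is a convex function of d, equal to e / m at the average degree
2e / m, so by Jensen some w has h(w) <= B(d(w)).  Deleting that w and
inducting on m loses only the second-order terms, at most m per step.
*)
Require Import Defs.
From mathcomp Require Import all_boot all_order all_algebra.
From mathcomp Require Import ring lra.
Import Order.TTheory GRing.Theory Num.Theory.
Local Open Scope ring_scope.

Definition degree {V : finType} (E : {set {set V}}) (w : V) : nat :=
  #|[set T in E | w \in T]|.

(** For a pair [e] = uv this is the set N(uv) of the overview. *)
Definition conbr {V : finType} (H : {set {set V}}) (U e : {set V}) : {set V} :=
  [set w in U | (w \notin e) && (w |: e \in H)].

Section SetFamilies.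

Variable V : finType.
Implicit Types (E H : {set {set V}}) (U e : {set V}) (w : V).

Lemma card_induced_delete E U w :
  #|induced E U| = (degree (induced E U) w + #|induced E (U :\ w)|)%N.
Proof.
rewrite -(cardsID [set T : {set V} | w \in T]) /degree; congr (_ + _)%N.
  by apply: eq_card => T; rewrite !inE.
by apply: eq_card => T; rewrite !inE subsetD1 andbCA; case: (_ \in E);
  rewrite ?andbF //= andbC.
Qed.

Lemma sum_degree_induced k E U :
  uniform k E -> (\sum_(w in U) degree (induced E U) w = k * #|induced E U|)%N.
Proof.
move=> Ek.
under eq_bigr => w _ do rewrite /degree -sum1_card.
rewrite (exchange_big_dep (mem (induced E U))) /=; last first.
  by move=> w T _; rewrite inE => /andP[].
rewrite mulnC -sum_nat_const; apply: eq_bigr => T TE.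
have [TE' TU] : T \in E /\ T \subset U by move: TE; rewrite inE => /andP[].
rewrite sum1_card -(Ek _ TE'); apply: eq_card => w.
rewrite unfold_in /= !inE TE' TU /= andbC.
by case wT: (w \in T); rewrite //= (subsetP TU).
Qed.

End SetFamilies.

(** * Independence of N(uv) and the weighted degree sum *)

Section Cancellative.

Variables (V : finType) (H : {set {set V}}).
Hypotheses (H3 : is_3graph H) (Hc : cancellative H).
Implicit Types (U e : {set V}) (w : V).

Lemma uniform_shadow : uniform 2 (shadow H).
Proof. by move=> e; rewrite inE => /andP[/eqP]. Qed.

(** The union of the three edges, as a subtype, is a vertex set of size at most 5. The preimages of
    the edges there form a member of T_3, and [val] embeds it in [H]. *)
Lemma cancellative_triple (A B C : {set V}) :
    A \in H -> B \in H -> C \in H -> A != B -> A != C -> B != C ->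
    (#|A :|: B :|: C| <= 5)%N -> ~~ (symdiff A B \subset C).
Proof.
move=> AH BH CH AB AC BC card5; apply/negP => sdABC.
pose S := A :|: B :|: C.
pose pre (X : {set V}) : {set {x | x \in S}} := val @^-1: X.
have preK (X : {set V}) : X \subset S -> val @: pre X = X.
  move=> /subsetP XS; apply/setP => x; apply/imsetP/idP.
    by case=> y; rewrite inE => yX ->.
  by move=> xX; exists (Sub x (XS x xX)); rewrite ?inE SubK.
have AS : A \subset S by rewrite /S -setUA subsetUl.
have BS : B \subset S by rewrite /S setUAC subsetUr.
have CS : C \subset S by rewrite subsetUr.
have preD (X Y : {set V}) :
    X \subset S -> Y \subset S -> X != Y -> pre X != pre Y.
  by move=> XS YS; apply: contraNneq => XY; rewrite -(preK X) // XY preK.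
apply: (Hc _ [set pre A; pre B; pre C]); last first.
  exists val; split; first exact: val_inj.
  by move=> e; rewrite !inE => /orP[/orP[]|] /eqP ->; rewrite preK.
split.
- move=> e eF; rewrite -(card_imset _ val_inj).
  by move: eF; rewrite !inE => /orP[/orP[]|] /eqP ->;
    rewrite preK //; apply: H3.
- by rewrite card_sig.
- by rewrite setUC cardsU1 cards2 !inE ![pre C == _]eq_sym negb_or !preD.
- exists (pre A), (pre B), (pre C); split => //.
  apply/subsetP => x; have := subsetP sdABC (val x).
  by rewrite /symdiff !inE.
Qed.

(** If an edge [C] contained both [w] and [w'], then [w |: e] and [w' |: e], whose symmetric
    difference is the pair [[set w; w']], would form a forbidden triple with [C]. *)
Lemma conbr_nonadjacent U e w w' :
  #|e| = 2 -> w \in conbr H U e -> w' \in conbr H U e ->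
  [set w; w'] \notin shadow H.
Proof.
move=> e2; rewrite !inE => /and3P[_ we weH] /and3P[_ w'e w'eH].
apply/negP => /andP[]; rewrite cards2 => ww' /existsP[C /andP[CH wC]].
have nww' : w != w' by move: ww'; case: (w != w').
have [wC1 w'C] : w \in C /\ w' \in C.
  by split; apply: (subsetP wC); rewrite !inE eqxx ?orbT.
have w'A : w' \notin w |: e by rewrite !inE negb_or eq_sym nww'.
have wB : w \notin w' |: e by rewrite !inE negb_or nww'.
suff : ~~ (symdiff (w |: e) (w' |: e) \subset C).
  apply/negP; rewrite negbK; apply/subsetP => x; rewrite !inE.
  case: (x \in e); rewrite ?orbT //= !orbF.
  by case/orP=> /andP[_ /eqP ->].
apply: cancellative_triple => //.
- by apply: contraNneq wB => <-; rewrite setU11.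
- by apply: contraNneq w'A => ->.
- by apply: contraNneq wB => ->.
(* [C] contains [w] and [w'], so the three edges span at most 2 + 3 vertices. *)
have sub : (w |: e) :|: (w' |: e) :|: C \subset e :|: C.
  apply/subsetP => x; rewrite !inE => /orP[/orP[]|->]; rewrite ?orbT //;
    by case/orP=> [/eqP ->|->]; rewrite ?wC1 ?w'C ?orbT.
apply: leq_trans (subset_leq_card sub) _.
by apply: leq_trans (leq_card_setU _ _) _; rewrite e2 H3.
Qed.

Lemma degree_shadow_le U w :
  (degree (induced (shadow H) U) w
     <= #|[set y in U :\ w | [set w; y] \in shadow H]|)%N.
Proof.
apply: leq_trans (leq_imset_card (fun y => [set w; y]) _).
apply: subset_leq_card; apply/subsetP => T; rewrite inE => /andP[].
rewrite inE => /andP[TS TU] wT.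
have T2 := uniform_shadow _ TS.
have /cards1P[y Ty] : #|T :\ w| == 1%N.
  by rewrite -(eqn_add2l 1); have := cardsD1 w T; rewrite wT T2 => <-.
have TE : T = [set w; y] by rewrite -(setD1K wT) Ty.
apply/imsetP; exists y => //; rewrite inE -TE TS andbT.
by apply: (subsetP (setSD _ TU)); rewrite Ty set11.
Qed.

Lemma degree_ltn_card U w :
  w \in U -> (degree (induced (shadow H) U) w < #|U|)%N.
Proof.
move=> wU; rewrite [ltnRHS](cardsD1 w) wU ltnS.
apply: leq_trans (degree_shadow_le U w) (subset_leq_card _).
by apply/subsetP => y; rewrite inE => /andP[].
Qed.

Lemma card_conbr_degree U e w :
  #|e| = 2 -> w \in conbr H U e ->
  (#|conbr H U e| + degree (induced (shadow H) U) w <= #|U|)%N.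
Proof.
move=> e2 wN; apply: leq_trans (leq_add (leqnn _) (degree_shadow_le U w)) _.
set Nb := [set y in _ | _].
have NbU : Nb \subset U.
  by apply/subsetP => y; rewrite inE => /andP[/setD1P[]].
have NN : conbr H U e \subset U :\: Nb.
  apply/subsetP => y yN; have /negPf nadj := conbr_nonadjacent U e w y e2 wN yN.
  rewrite in_setD in_set nadj andbF.
  by move: yN; rewrite inE => /andP[->].
rewrite -[leqRHS](cardsID Nb) addnC leq_add ?subset_leq_card //.
by rewrite subsetI NbU subxx.
Qed.

(** Sending an edge [T] through [w] to the pair [T :\ w] is injective. *)
Lemma degree_conbr U w :
  w \in U ->
  (degree (induced H U) w
     <= #|[set e in induced (shadow H) U | w \in conbr H U e]|)%N.
Proof.
move=> wU.
have injD : {in [set T in induced H U | w \in T] &,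
    injective (fun T : {set V} => T :\ w)}.
  move=> T T'; rewrite !inE => /andP[_ wT] /andP[_ wT'] TT'.
  by rewrite -(setD1K wT) TT' setD1K.
rewrite /degree -(card_in_imset injD); apply/subset_leq_card/subsetP => D.
case/imsetP=> T; rewrite inE => /andP[]; rewrite inE => /andP[TH TU] wT ->{D}.
rewrite !inE wU eqxx setD1K // TH !andbT.
rewrite (subset_trans (subD1set _ _) TU) !andbT.
apply/andP; split; last by apply/existsP; exists T; rewrite TH subD1set.
by rewrite -(eqn_add2l 1); have := cardsD1 w T; rewrite wT (H3 _ TH) => <-.
Qed.

Lemma sum_degree_div_le (R : realFieldType) U :
  \sum_(w in U) (degree (induced H U) w)%:R
      / (#|U|%:R - (degree (induced (shadow H) U) w)%:R)
    <= #|induced (shadow H) U|%:R :> R.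
Proof.
set G := induced (shadow H) U.
pose a w : R := #|U|%:R - (degree G w)%:R.
have a_gt0 w : w \in U -> 0 < a w.
  by move=> wU; rewrite subr_gt0 ltr_nat degree_ltn_card.
(* Double counting: each pair [e] now collects the weights of the vertices in N(e), and it remains
   to see that they total at most 1. *)
apply: (@le_trans _ _ (\sum_(e in G) \sum_(w in conbr H U e) (a w)^-1)).
  rewrite (exchange_big_dep (mem U)) /=; last first.
    by move=> e w _; rewrite inE => /andP[].
  apply: ler_sum => w wU.
  rewrite sumr_const -[leRHS]mulr_natl.
  apply: ler_wpM2r; first by rewrite invr_ge0 ltW ?a_gt0.
  rewrite ler_nat; apply: leq_trans (degree_conbr U w wU) _.
  by rewrite cardsE.
rewrite -[leRHS]mulr1 mulr_natl -sumr_const; apply: ler_sum => e eG.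
have e2 : #|e| = 2 by move: eG; rewrite inE => /andP[/uniform_shadow].
have [->|/set0Pn[w0 w0N]] := eqVneq (conbr H U e) set0.
  by rewrite big_set0.
have N_gt0 : 0 < #|conbr H U e|%:R :> R.
  by rewrite ltr0n card_gt0; apply/set0Pn; exists w0.
(* Spread 1 evenly over N(e); each weight is at most 1 / |N(e)|. *)
have -> : 1 = \sum_(w in conbr H U e) #|conbr H U e|%:R^-1 :> R.
  by rewrite sumr_const -[RHS]mulr_natl divff ?gt_eqF.
apply: ler_sum => w wN.
have wU : w \in U by move: wN; rewrite inE => /andP[].
rewrite lef_pV2 ?posrE ?a_gt0 // /a lerBrDr -natrD ler_nat.
exact: card_conbr_degree.
Qed.

End Cancellative.

(** * Real inequalities for the deletion of one vertex *)

Section Analysis.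

Variable R : realFieldType.

(* The vertex count [m] drops by one and the edge count [e] by [d]. *)
Lemma deletion_step (m e d h k : R) :
  1 <= m -> 0 <= e -> 0 <= d -> d <= m - 1 -> 2 * e <= m * (m - 1) ->
  h <= d * (m ^+ 2 - 4 * e) / (3 * m) + e * (m ^+ 2 + 2 * e) / (3 * m ^+ 2) ->
  k <= (e - d) * ((m - 1) ^+ 2 - 2 * (e - d)) / (3 * (m - 1))
       + 3 * (m - 1) ^+ 2 ->
  h + k <= e * (m ^+ 2 - 2 * e) / (3 * m) + 3 * m ^+ 2.
Proof.
rewrite le_eqVlt => /predU1P[<-|m_gt1] e0 d0 dm em hB kB.
  (* At m = 1 the bound on [k] divides by zero, so this case is separate. *)
  have e_eq0 : e = 0 by lra.
  have d_eq0 : d = 0 by lra.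
  by move: hB kB; rewrite e_eq0 d_eq0 subrr; lra.
have m_gt0 : 0 < m by lra.
have m1_gt0 : 0 < m - 1 by lra.
apply: le_trans (lerD hB kB) _; rewrite -subr_ge0.
have -> : e * (m ^+ 2 - 2 * e) / (3 * m) + 3 * m ^+ 2 -
  (d * (m ^+ 2 - 4 * e) / (3 * m) + e * (m ^+ 2 + 2 * e) / (3 * m ^+ 2) +
   ((e - d) * ((m - 1) ^+ 2 - 2 * (e - d)) / (3 * (m - 1)) + 3 * (m - 1) ^+ 2))
  = (6 * m - 3 - d / 3 - 4 / 3 * (d * e / m ^+ 2)) +
    2 / 3 * (d ^+ 2 * (m + 1) / m ^+ 2 + (e - d) ^+ 2 / (m ^+ 2 * (m - 1))).
  by field; rewrite !gt_eqF.
have de : d * e / m ^+ 2 <= d.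
  rewrite ler_pdivrMr ?exprn_gt0 //; apply: ler_wpM2l => //.
  by have := sqr_ge0 m; lra.
apply: addr_ge0; first by lra.
apply: mulr_ge0; first by lra.
by apply: addr_ge0; rewrite divr_ge0 ?sqr_ge0 ?mulr_ge0 ?sqr_ge0 //; lra.
Qed.

Lemma exists_low_ratio (I : finType) (U : {set I}) (d h : I -> R) (e : R) :
  let m := #|U|%:R in
  (0 < #|U|)%N -> 0 <= e -> (forall i, i \in U -> d i <= m - 1) ->
  \sum_(i in U) d i = 2 * e -> \sum_(i in U) h i / (m - d i) <= e ->
  exists2 i, i \in U &
    h i <= d i * (m ^+ 2 - 4 * e) / (3 * m)
           + e * (m ^+ 2 + 2 * e) / (3 * m ^+ 2).
Proof.
move=> m U0 e0 dm sumd sumh.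
have m_gt0 : 0 < m by rewrite ltr0n.
pose B x :=
  x * (m ^+ 2 - 4 * e) / (3 * m) + e * (m ^+ 2 + 2 * e) / (3 * m ^+ 2).
have [/exists_inP //|/exists_inPn hB] := boolP [exists i in U, h i <= B (d i)].
have a_gt0 i : i \in U -> 0 < m - d i by move=> /dm; lra.
have A_gt0 : 0 < m ^+ 2 - 2 * e.
  have : \sum_(i in U) d i <= \sum_(i in U) (m - 1) by apply: ler_sum.
  by rewrite sumd sumr_const -mulr_natl -/m; nra.
(* [K] is B(m). As B is affine, B(d) / (m - d) is [K / (m - d)] minus the slope of B, and [K >= 0]
   makes it convex for d < m. *)
pose K := (m ^+ 2 - e) * (m ^+ 2 - 2 * e) / (3 * m ^+ 2).
have K_ge0 : 0 <= K by rewrite divr_ge0 ?sqr_ge0 ?mulr_ge0 ?sqr_ge0 //; lra.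
pose A := (m ^+ 2 - 2 * e) / m.
have A0 : 0 < A by rewrite divr_gt0.
(* [2 / A - a / A ^+ 2] is the tangent line at [A] of the convex function
   [1 / a], and [A] is the mean of [a = m - d i]. *)
have tangent i : i \in U ->
    K * (2 / A - (m - d i) / A ^+ 2) - (m ^+ 2 - 4 * e) / (3 * m)
      < h i / (m - d i).
  move=> iU; have ai := a_gt0 i iU.
  have := hB i iU; rewrite -ltNge => hi.
  have BE : B (d i) / (m - d i)
      = K / (m - d i) - (m ^+ 2 - 4 * e) / (3 * m).
    by rewrite /B /K; field; rewrite !gt_eqF.
  apply: (@le_lt_trans _ _ (B (d i) / (m - d i))); last first.
    by rewrite ltr_pM2r ?invr_gt0.
  rewrite BE lerD2r ler_wpM2l // -subr_ge0.
  have -> : (m - d i)^-1 - (2 / A - (m - d i) / A ^+ 2)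
      = (A - (m - d i)) ^+ 2 / ((m - d i) * A ^+ 2).
    by field; rewrite !gt_eqF.
  by rewrite divr_ge0 ?sqr_ge0 // mulr_ge0 ?sqr_ge0 // ltW.
have [i0 i0U] : exists i, i \in U by apply/set0Pn; rewrite -card_gt0.
have : e < e; last by rewrite ltxx.
apply: lt_le_trans sumh.
(* The tangent is affine, so its sum is m times its value at the mean [A], that is m * (e / m). *)
suff <- : \sum_(i in U)
    (K * (2 / A - (m - d i) / A ^+ 2) - (m ^+ 2 - 4 * e) / (3 * m)) = e.
  by apply: ltr_sum => //; apply/hasP; exists i0; rewrite ?mem_index_enum.
under eq_bigr => i _.
  have -> : K * (2 / A - (m - d i) / A ^+ 2) - (m ^+ 2 - 4 * e) / (3 * m)
      = K * (2 / A - m / A ^+ 2) - (m ^+ 2 - 4 * e) / (3 * m)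
        + K / A ^+ 2 * d i by ring.
  over.
rewrite big_split -mulr_sumr sumd sumr_const -[_ *+ #|U|]mulr_natl -/m /=.
by rewrite /K /A; field; rewrite !gt_eqF.
Qed.

End Analysis.

(** * Induction on the size of [U] *)

Lemma card_induced_cancellative (R : realFieldType) (V : finType)
    (H : {set {set V}}) (U : {set V}) :
  is_3graph H -> cancellative H ->
  #|induced H U|%:R
    <= #|induced (shadow H) U|%:R
         * (#|U|%:R ^+ 2 - 2 * #|induced (shadow H) U|%:R) / (3 * #|U|%:R)
       + 3 * #|U|%:R ^+ 2 :> R.
Proof.
move=> H3 Hc; have [k Uk] : exists k, #|U| = k by exists #|U|.
elim: k U Uk => [|k IH] U Uk.
  (* For empty [U] the quotient by 0 is 0, and no edge fits since edges have three vertices. *)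
  have U0 := cards0_eq Uk.
  suff -> : induced H U = set0.
    by rewrite cards0 Uk mulr0 invr0 mulr0 add0r expr0n mulr0.
  apply/setP => T; rewrite !inE U0 subset0.
  by apply/andP => -[/H3 + /eqP T0]; rewrite T0 cards0.
set G := induced (shadow H) U; set m := #|U|%:R; set e := #|G|%:R.
have m1 : 1 <= m by rewrite /m Uk ler1n.
have dm w : w \in U -> (degree G w)%:R <= m - 1.
  move=> wU; rewrite lerBrDr natr1 ler_nat.
  exact: degree_ltn_card.
have sumd : \sum_(w in U) (degree G w)%:R = 2 * e.
  by rewrite -natr_sum (sum_degree_induced _ 2) ?natrM //;
    apply: uniform_shadow.
have [w wU hw] := exists_low_ratio R V U (fun w => (degree G w)%:R)
  (fun w => (degree (induced H U) w)%:R) e ltac:(by rewrite Uk) (ler0n _ _)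
  dm sumd (sum_degree_div_le V H H3 Hc R U).
have Uw : #|U :\ w| = k by apply: succn_inj; rewrite -Uk (cardsD1 w U) wU.
have mE : #|U :\ w|%:R = m - 1 :> R by rewrite /m Uw Uk -natr1 addrK.
have eE : #|induced (shadow H) (U :\ w)|%:R = e - (degree G w)%:R :> R.
  by rewrite /e (card_induced_delete _ _ U w) natrD addrC addKr.
have em : 2 * e <= m * (m - 1).
  rewrite -sumd; apply: le_trans (ler_sum _ dm) _.
  by rewrite sumr_const -mulr_natl.
have IHw := IH (U :\ w) Uw.
rewrite (card_induced_delete _ _ U w) natrD.
apply: (deletion_step R m e (degree G w)%:R) => //; try exact: ler0n.
- exact: dm.
- by move: IHw; rewrite mE eE.
Qed.

Theorem theorem4p7 (R : realFieldType) (V : finType) (n : nat)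
    (H : {set {set V}}) (U : {set V}) (m : nat) (x : R)
    (hn : #|V| = n)
    (hH : is_3graph H)
    (hcanc : cancellative H)
    (hm : #|U| = m)
    (hx0 : 0 <= x)
    (hx1 : x <= (m%:R - 1) / m%:R)
    (hG : #|induced (shadow H) U|%:R = x * m%:R ^+ 2 / 2%:R) :
  #|induced H U|%:R <= (1 - x) * x / 6%:R * m%:R ^+ 3 + 3%:R * m%:R ^+ 2.
Proof.
have := card_induced_cancellative R V H U hH hcanc.
(* With e = x m^2 / 2 the main term e (m^2 - 2e) / (3m) becomes (1 - x) x m^3 / 6; at m = 0 both are
   0. *)
rewrite hG hm; congr (_ <= _ + _).
have [->|m0] := eqVneq (m%:R : R) 0; first by rewrite !expr0n /= !mulr0 !mul0r.
by field.
Qed.
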